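(* Let $L=[h_1,\dots,h_6]$ be a 6R linkage with $\dim_{\mathbb{C}}K_{sym}<2$. Assume that $K_{sym}$ contains a non-degenerate component of dimension $1$ which is contained in $K_{sym}^+$. Then $r:=\operatorname{rank}(\mathbf{M}^{\dagger})\in\{2,3,4\}$.
   Context: Let $\mathbb{DH}$ be the algebra of dual quaternions, the 8-dimensional real algebra with basis $1,\mathbf i,\mathbf j,\mathbf k,\epsilon,\epsilon\mathbf i,\epsilon\mathbf j,\epsilon\mathbf k$, where $\mathbf i,\mathbf j,\mathbf k$ multiply as quaternions, $\epsilon$ is central and $\epsilon^2=0$. A (rotation) line is represented by $h\in\mathbb{DH}$ with $h^2=-1$; the rotation about it by angle $\phi$ is represented, up to nonzero real scalars, by $t-h$ with $t=\cot(\phi/2)\in\mathbb{R}\cup\{\infty\}$, where for $t=\infty$ the factor $t-h$ (and likewise $t+h$) is read as $1$. A 6R linkage is a tuple $L=[h_1,\dots,h_6]$ of dual quaternions with $h_i^2=-1$ for all $i$. Its configuration set $K_L$ is the set of $(t_1,\dots,t_6)\in(\mathbb{R}\cup\{\infty\})^6$ with $(t_1-h_1)(t_2-h_2)\cdots(t_6-h_6)\in\mathbb{R}\setminus\{0\}$. $K_{sym}$ is the subset of $K_L$ with $t_1=t_4$, $t_2=t_5$, $t_3=t_6$; its points are written $(t_1,t_2,t_3)$. $\dim_{\mathbb{C}}K_{sym}$ is the dimension of the set of complex solutions of the same conditions ($t_i\in\mathbb{C}\cup\{\infty\}$, product in $\mathbb{C}\setminus\{0\}$). A non-degenerate component of $K_{sym}$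 is an irreducible one-dimensional component on which none of the coordinates $t_1,t_2,t_3$ is constant. For $(t_1,t_2,t_3)\in K_{sym}$ one has $(t_1-h_1)(t_2-h_2)(t_3-h_3)=\lambda(t_3+h_6)(t_2+h_5)(t_1+h_4)$ with $\lambda\in\{1,-1\}$; $K_{sym}^+$ is the subset of $K_{sym}$ where $\lambda=1$. Put $g_i=h_i+h_{i+3}$ for $i=1,2,3$. The matrix $\mathbf{M}^{\dagger}$ (the $\lambda$-matrix of $L$) is the $6\times 7$ matrix over $\mathbb{DH}$ $$\left[\begin{array}{ccccccc} g_3&g_2&g_1&h_5h_4-h_1h_2&h_6h_4-h_1h_3&h_6h_5-h_2h_3&h_6h_5h_4+h_1h_2h_3\\ g_3&g_2&g_1&h_1h_5-h_2h_4&h_1h_6-h_3h_4&h_6h_5-h_2h_3&h_1h_6h_5+h_2h_3h_4\\ g_3&g_2&g_1&h_2h_1-h_4h_5&h_1h_6-h_3h_4&h_2h_6-h_3h_5&h_2h_1h_6+h_3h_4h_5\\ g_3&g_2&g_1&h_2h_1-h_4h_5&h_3h_1-h_4h_6&h_3h_2-h_5h_6&h_3h_2h_1+h_4h_5h_6\\ g_3&g_2&g_1&h_4h_2-h_5h_1&h_4h_3-h_6h_1&h_3h_2-h_5h_6&h_4h_3h_2+h_5h_6h_1\\ g_3&g_2&g_1&h_5h_4-h_1h_2&h_4h_3-h_6h_1&h_5h_3-h_6h_2&h_5h_4h_3+h_6h_1h_2 \end{array}\right].$$ It is regarded as a real $48\times 7$ matrix by replacing each entry by the column of its 8 real coordinates,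 and $\operatorname{rank}(\mathbf{M}^{\dagger})$ is its real rank. *)

(* Defs.v *)
From HB Require Import structures.
From mathcomp Require Import all_boot all_order all_algebra.
From mathcomp Require Import ring classical_sets reals complex.

Set Implicit Arguments.
Unset Strict Implicit.
Unset Printing Implicit Defensive.

Import GRing.Theory.
Local Open Scope ring_scope.

(* Quaternions over F, with coordinates in the basis 1, i, j, k.  The ground
   ring is a parameter because the dual quaternions are needed both over the
   reals and over the complex numbers. *)
Definition quat (F : Type) : Type := 'rV[F]_4.

Definition quat_one (F : comNzRingType) : quat F :=
  \row_(l < 4) [:: 1; 0; 0; 0]`_l.

Definition quat_mul (F : comNzRingType) (x y : quat F) : quat F :=
  let: (x0, x1, x2, x3) :=
    (x 0 (inord 0), x 0 (inord 1), x 0 (inord 2), x 0 (inord 3)) in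
  let: (y0, y1, y2, y3) :=
    (y 0 (inord 0), y 0 (inord 1), y 0 (inord 2), y 0 (inord 3)) in
  \row_(l < 4) [:: x0 * y0 - x1 * y1 - x2 * y2 - x3 * y3;
                   x0 * y1 + x1 * y0 + x2 * y3 - x3 * y2;
                   x0 * y2 - x1 * y3 + x2 * y0 + x3 * y1;
                   x0 * y3 + x1 * y2 - x2 * y1 + x3 * y0]`_l.

Section QuatAlgebra.
Variable F : comNzRingType.
Local Notation Q := (quat F).

Lemma quatP (x y : Q) :
  (forall l, (l < 4)%N -> x 0 (inord l) = y 0 (inord l)) -> x = y.
Proof.
by move=> exy; apply/rowP => l; have := exy l (ltn_ord l); rewrite inord_val.
Qed.

HB.instance Definition _ := GRing.Lmodule.copy Q 'rV[F]_4.

Ltac quat_ring :=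
  apply: quatP; do 4?[case=> [|] //]; rewrite /quat_mul /quat_one ?mxE;
  rewrite ?inordK //= ?mxE ?inordK //=; move=> _; ring.

Fact quat_mulA : associative (@quat_mul F).
Proof. by move=> x y z; quat_ring. Qed.

Fact quat_mul1l : left_id (@quat_one F) (@quat_mul F).
Proof. by move=> x; quat_ring. Qed.

Fact quat_mul1r : right_id (@quat_one F) (@quat_mul F).
Proof. by move=> x; quat_ring. Qed.

Fact quat_mulDl : left_distributive (@quat_mul F) +%R.
Proof. by move=> x y z; quat_ring. Qed.

Fact quat_mulDr : right_distributive (@quat_mul F) +%R.
Proof. by move=> x y z; quat_ring. Qed.

Fact quat_one_neq0 : @quat_one F != 0 :> Q.
Proof.
by apply/eqP => /rowP/(_ 0); rewrite !mxE /= => /eqP; rewrite oner_eq0.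
Qed.

HB.instance Definition _ := GRing.Zmodule_isNzRing.Build Q
  quat_mulA quat_mul1l quat_mul1r quat_mulDl quat_mulDr quat_one_neq0.

Fact quat_mulE (x y : Q) : x * y = quat_mul x y.
Proof. by []. Qed.

Fact quat_scaleAl (a : F) (x y : Q) : a *: (x * y) = (a *: x) * y.
Proof. by rewrite !quat_mulE; quat_ring. Qed.

HB.instance Definition _ := GRing.Lmodule_isLalgebra.Build F Q quat_scaleAl.

Fact quat_scaleAr (a : F) (x y : Q) : a *: (x * y) = x * (a *: y).
Proof. by rewrite !quat_mulE; quat_ring. Qed.

HB.instance Definition _ := GRing.Lalgebra_isAlgebra.Build F Q quat_scaleAr.

End QuatAlgebra.

(* The row vector of the 8 coordinates in the basis 1, i, j, k, eps, eps i,
   eps j, eps k, so that row_mx p q stands for p + eps q. *)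
Definition dualquat (F : Type) : Type := 'rV[F]_(4 + 4).

Section DualQuatAlgebra.
Variable F : comNzRingType.
Local Notation DH := (dualquat F).

Definition primal (x : DH) : quat F := lsubmx x.
Definition dual (x : DH) : quat F := rsubmx x.

Definition dualquat_one : DH := row_mx (1 : quat F) 0.

Definition dualquat_mul (x y : DH) : DH :=
  row_mx (primal x * primal y) (primal x * dual y + dual x * primal y).

HB.instance Definition _ := GRing.Lmodule.copy DH 'rV[F]_(4 + 4).

Fact dualquatP (x y : DH) : primal x = primal y -> dual x = dual y -> x = y.
Proof.
rewrite /primal /dual => ep ed.
by rewrite -[LHS]hsubmxK -[RHS]hsubmxK ep ed.
Qed.

Fact primal_row (p q : quat F) : primal (row_mx p q) = p.
Proof. exact: row_mxKl. Qed.

Fact dual_row (p q : quat F) : dual (row_mx p q) = q.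
Proof. exact: row_mxKr. Qed.

Fact primalD (x y : DH) : primal (x + y) = primal x + primal y.
Proof. exact: raddfD. Qed.

Fact dualD (x y : DH) : dual (x + y) = dual x + dual y.
Proof. exact: raddfD. Qed.

Fact primalZ (a : F) (x : DH) : primal (a *: x) = a *: primal x.
Proof. exact: linearZ. Qed.

Fact dualZ (a : F) (x : DH) : dual (a *: x) = a *: dual x.
Proof. exact: linearZ. Qed.

Let dqE := (primal_row, dual_row, primalD, dualD, primalZ, dualZ).

Fact dualquat_mulA : associative dualquat_mul.
Proof.
move=> x y z; apply: dualquatP; rewrite !dqE mulrA //.
by rewrite mulrDr mulrDl !mulrA addrA.
Qed.

Fact dualquat_mul1l : left_id dualquat_one dualquat_mul.
Proof. by move=> x; apply: dualquatP; rewrite !dqE mul1r // mul0r addr0. Qed.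

Fact dualquat_mul1r : right_id dualquat_one dualquat_mul.
Proof. by move=> x; apply: dualquatP; rewrite !dqE mulr1 // mulr0 add0r. Qed.

Fact dualquat_mulDl : left_distributive dualquat_mul +%R.
Proof.
by move=> x y z; apply: dualquatP; rewrite !dqE !mulrDl // addrACA.
Qed.

Fact dualquat_mulDr : right_distributive dualquat_mul +%R.
Proof.
by move=> x y z; apply: dualquatP; rewrite !dqE !mulrDr // addrACA.
Qed.

Fact dualquat_one_neq0 : dualquat_one != 0 :> DH.
Proof.
apply/eqP => /(congr1 primal); rewrite primal_row => e1.
have := oner_neq0 (quat F).
by rewrite e1 /primal raddf0 eqxx.
Qed.

HB.instance Definition _ := GRing.Zmodule_isNzRing.Build DH
  dualquat_mulA dualquat_mul1l dualquat_mul1r dualquat_mulDl dualquat_mulDr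
  dualquat_one_neq0.

Fact dualquat_mulE (x y : DH) : x * y = dualquat_mul x y.
Proof. by []. Qed.

Fact dualquat_scaleAl (a : F) (x y : DH) : a *: (x * y) = (a *: x) * y.
Proof.
by apply: dualquatP; rewrite !dualquat_mulE !dqE ?scalerDr !scalerAl.
Qed.

HB.instance Definition _ :=
  GRing.Lmodule_isLalgebra.Build F DH dualquat_scaleAl.

Fact dualquat_scaleAr (a : F) (x y : DH) : a *: (x * y) = x * (a *: y).
Proof.
by apply: dualquatP; rewrite !dualquat_mulE !dqE ?scalerDr !scalerAr.
Qed.

HB.instance Definition _ :=
  GRing.Lalgebra_isAlgebra.Build F DH dualquat_scaleAr.

End DualQuatAlgebra.

(* The projective line F u {oo}, with None for oo. *)
Notation P1 F := (option F).

Definition fac_sub (F : comNzRingType) (t : P1 F) (h : dualquat F) :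
  dualquat F := if t is Some x then x%:A - h else 1.

Definition fac_add (F : comNzRingType) (t : P1 F) (h : dualquat F) :
  dualquat F := if t is Some x then x%:A + h else 1.

(* A linkage [h_1, ..., h_6] is stored with indices starting at 0: h_i is
   L`_(i-1), and the coordinate t_i of a configuration t is t (i-1). *)
Definition linkage6R (F : comNzRingType) (L : 6.-tuple (dualquat F)) : Prop :=
  forall i : 'I_6, tnth L i ^+ 2 = -1.

Local Open Scope classical_set_scope.

Definition Kconf (F : comNzRingType) (L : 6.-tuple (dualquat F)) :
    set ('I_6 -> P1 F) :=
  [set t | exists2 c : F, c != 0 &
     \prod_(i < 6) fac_sub (t i) (tnth L i) = c%:A].

Definition Ksym (F : comNzRingType) (L : 6.-tuple (dualquat F)) :
    set ('I_3 -> P1 F) :=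
  [set t | Kconf L (fun i : 'I_6 => t (inord (i %% 3)))].

Definition Ksym_plus (F : comNzRingType) (L : 6.-tuple (dualquat F)) :
    set ('I_3 -> P1 F) :=
  [set t | Ksym L t /\
    let t1 := t (inord 0) in let t2 := t (inord 1) in let t3 := t (inord 2) in
    fac_sub t1 L`_0 * fac_sub t2 L`_1 * fac_sub t3 L`_2 =
    fac_add t3 L`_5 * fac_add t2 L`_4 * fac_add t1 L`_3].

Section Zariski.
Variable F : fieldType.

(* Homogeneous coordinates: x is (x : 1) and oo is (1 : 0). *)
Definition hcoord (t : P1 F) : F * F := if t is Some x then (x, 1) else (1, 0).

(* A trihomogeneous form of tridegree (d 0, d 1, d 2) in
   (X_0, Y_0; X_1, Y_1; X_2, Y_2); coef a b c is the coefficient of the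
   monomial with X-exponents (a, b, c). *)
Record triform := Triform {
  tridegree : 'I_3 -> nat;
  tricoef : nat -> nat -> nat -> F }.

Definition triform_eval (f : triform) (t : 'I_3 -> P1 F) : F :=
  let d := tridegree f in
  let mon (i : 'I_3) (k : nat) :=
    (hcoord (t i)).1 ^+ k * (hcoord (t i)).2 ^+ (d i - k) in
  \sum_(a < (d (inord 0)).+1) \sum_(b < (d (inord 1)).+1)
    \sum_(c < (d (inord 2)).+1)
      tricoef f a b c * (mon (inord 0) a * mon (inord 1) b * mon (inord 2) c).

Definition zclosed (A : set ('I_3 -> P1 F)) : Prop :=
  exists S : set triform,
    A = [set t | forall f, S f -> triform_eval f t = 0].

Definition zclosed_in (X A : set ('I_3 -> P1 F)) : Prop :=
  exists2 C, zclosed C & A = X `&` C.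

Definition zirreducible (A : set ('I_3 -> P1 F)) : Prop :=
  A !=set0 /\
  forall C D, zclosed C -> zclosed D ->
    A `<=` C `|` D -> A `<=` C \/ A `<=` D.

(* Krull dimension of X for the subspace topology, as a relation so that no
   value has to be chosen for the empty set: dim X >= n. *)
Definition zdim_ge (X : set ('I_3 -> P1 F)) (n : nat) : Prop :=
  exists Z : nat -> set ('I_3 -> P1 F),
    (forall i, (i <= n)%N -> zclosed_in X (Z i) /\ zirreducible (Z i)) /\
    (forall i, (i < n)%N -> Z i `<` Z i.+1).

Definition zdim_lt (X : set ('I_3 -> P1 F)) (n : nat) : Prop := ~ zdim_ge X n.

Definition zdim_eq (X : set ('I_3 -> P1 F)) (n : nat) : Prop :=
  zdim_ge X n /\ zdim_lt X n.+1.

(* Maximality makes C closed in X. *)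
Definition zcomponent (X C : set ('I_3 -> P1 F)) : Prop :=
  [/\ C `<=` X, zirreducible C &
      forall D, zirreducible D -> C `<=` D -> D `<=` X -> D = C].

End Zariski.

Definition nondegenerate_component (F : fieldType)
    (L : 6.-tuple (dualquat F)) (C : set ('I_3 -> P1 F)) : Prop :=
  [/\ zcomponent (Ksym L) C, zdim_eq C 1 &
      forall i : 'I_3, ~ exists a : P1 F, forall t, C t -> t i = a].

Local Close Scope classical_set_scope.

Definition complexify (R : rcfType) (L : 6.-tuple (dualquat R)) :
    6.-tuple (dualquat R[i]) :=
  map_tuple (map_mx (real_complex R) : dualquat R -> dualquat R[i]) L.

Definition lambda_matrix (F : comNzRingType) (L : 6.-tuple (dualquat F)) :
    'M[dualquat F]_(6, 7) :=
  let h1 := L`_0 in let h2 := L`_1 in let h3 := L`_2 in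
  let h4 := L`_3 in let h5 := L`_4 in let h6 := L`_5 in
  let g1 := h1 + h4 in let g2 := h2 + h5 in let g3 := h3 + h6 in
  \matrix_(i < 6, j < 7)
    (nth [::]
    [:: [:: g3; g2; g1; h5 * h4 - h1 * h2; h6 * h4 - h1 * h3;
            h6 * h5 - h2 * h3; h6 * h5 * h4 + h1 * h2 * h3];
        [:: g3; g2; g1; h1 * h5 - h2 * h4; h1 * h6 - h3 * h4;
            h6 * h5 - h2 * h3; h1 * h6 * h5 + h2 * h3 * h4];
        [:: g3; g2; g1; h2 * h1 - h4 * h5; h1 * h6 - h3 * h4;
            h2 * h6 - h3 * h5; h2 * h1 * h6 + h3 * h4 * h5];
        [:: g3; g2; g1; h2 * h1 - h4 * h5; h3 * h1 - h4 * h6;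
            h3 * h2 - h5 * h6; h3 * h2 * h1 + h4 * h5 * h6];
        [:: g3; g2; g1; h4 * h2 - h5 * h1; h4 * h3 - h6 * h1;
            h3 * h2 - h5 * h6; h4 * h3 * h2 + h5 * h6 * h1];
        [:: g3; g2; g1; h5 * h4 - h1 * h2; h4 * h3 - h6 * h1;
            h5 * h3 - h6 * h2; h5 * h4 * h3 + h6 * h1 * h2]] i)`_j.

(* Each entry is replaced by the column of its 8 coordinates. *)
Definition coord_matrix (F : Type) (m n : nat) (M : 'M[dualquat F]_(m, n)) :
    'M[F]_(\sum_(i < m) 8, n) :=
  \mxcol_(i < m) \matrix_(k < 8, j < n) (M i j : 'rV[F]_8) 0 k.

(* Main.v *)
Require Import Defs.
From mathcomp Require Import all_boot all_order all_algebra.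
From mathcomp Require Import ring classical_sets boolp reals complex.
(* Multiplying out (t1-h1)(t2-h2)(t3-h3) = (t3+h6)(t2+h5)(t1+h4) and its five
   cyclic rotations shows that each finite point of K_sym^+ puts the vector
   (t1t2, t1t3, t2t3, t3, t2, t1, 1) in the kernel of the lambda-matrix.  On a
   non-degenerate component there are three points with pairwise distinct t1,
   two of them with distinct t2; their vectors are independent, so the rank is
   at most 4.  If the rank were at most 1, all equations of the first row would
   be multiples of a single equation A z + B = 0, with real A and B depending on
   two of the variables x, y and A nonzero.  Then complex points
   (x, y, -B/A) would lie in K_sym away from x^2 + 1 = 0, y^2 + 1 = 0 and
   A^2 + B^2 = 0, so that the complex K_sym would have dimension at least 2. *)
Set Implicit Arguments.
Unset Strict Implicit.
Unset Printing Implicit Defensive.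
Import Order.TTheory GRing.Theory Num.Theory.
Local Open Scope ring_scope.
Local Open Scope classical_set_scope.

(** * Zariski closed sets of (P^1)^3 *)

Section Triforms.
Variable F : fieldType.
Implicit Types (t : 'I_3 -> P1 F) (d k : 'I_3 -> nat).

(** The monomial with X-exponents [k] in tridegree [d]. Subtraction is truncated, so it has this
    tridegree only when [k i <= d i]; hence the bounds assumed below. *)
Definition trimon d k t : F :=
  \prod_(i < 3) ((hcoord (t i)).1 ^+ k i * (hcoord (t i)).2 ^+ (d i - k i)).

(** A property of the function and not of its coefficients, so that a product is recognised as a
    form without computing convolutions. *)
Definition is_triform d (G : ('I_3 -> P1 F) -> F) : Prop :=
  exists co, forall t, G t = triform_eval (Triform d co) t.

Definition exponents (a b c : nat) : 'I_3 -> nat :=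
  fun i => [:: a; b; c]`_i.

Lemma exponents_eta k (i : 'I_3) :
  exponents (k (inord 0)) (k (inord 1)) (k (inord 2)) i = k i.
Proof.
by rewrite -(inord_val i); case: i => [[|[|[|]]]] //= ?; rewrite /exponents inordK.
Qed.

Lemma big_ord3_inord (V : Type) (idx : V) (op : Monoid.law idx) (G : 'I_3 -> V) :
  \big[op/idx]_(i < 3) G i = op (op (G (inord 0)) (G (inord 1))) (G (inord 2)).
Proof.
rewrite !big_ord_recr big_ord0 Monoid.mul1m.
by congr (op (op (G _) (G _)) (G _)); apply: val_inj; rewrite /= inordK.
Qed.

Lemma triform_evalE d co t :
  triform_eval (Triform d co) t =
  \sum_(a < (d (inord 0)).+1) \sum_(b < (d (inord 1)).+1)
    \sum_(c < (d (inord 2)).+1) co a b c * trimon d (exponents a b c) t.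
Proof.
rewrite /triform_eval /=; do 3!apply: eq_bigr => ? _.
by rewrite /trimon big_ord3_inord /exponents !inordK.
Qed.

Lemma is_triform_sum d (I : Type) (r : seq I) (P : pred I) G :
  (forall i, P i -> is_triform d (G i)) ->
  is_triform d (fun t => \sum_(i <- r | P i) G i t).
Proof.
move=> hG; elim: r => [|i r [co IH]].
  exists (fun _ _ _ => 0) => t; rewrite big_nil triform_evalE.
  by do 3!rewrite big1 // => ? _; rewrite mul0r.
have [Pi|nPi] := boolP (P i); last first.
  by exists co => t; rewrite big_cons (negbTE nPi).
have [co' h] := hG i Pi; exists (fun a b c => co' a b c + co a b c) => t.
rewrite big_cons Pi IH h !triform_evalE -big_split; apply: eq_bigr => a _.
rewrite -big_split; apply: eq_bigr => b _.
by rewrite -big_split; apply: eq_bigr => c _; rewrite mulrDl.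
Qed.

Lemma is_triformZ d z G :
  is_triform d G -> is_triform d (fun t => z * G t).
Proof.
case=> co h; exists (fun a b c => z * co a b c) => t.
rewrite h !triform_evalE big_distrr; apply: eq_bigr => a _.
rewrite big_distrr; apply: eq_bigr => b _.
by rewrite big_distrr; apply: eq_bigr => c _; rewrite /= mulrA.
Qed.

Lemma sum_delta (n m : nat) (G : nat -> F) : (m < n)%N ->
  \sum_(a < n) (a == m :> nat)%:R * G a = G m.
Proof.
move=> lt_mn; rewrite (bigD1 (Ordinal lt_mn)) //= eqxx mul1r big1 ?addr0 //.
by move=> i /negPf; rewrite -val_eqE /= => ->; rewrite mul0r.
Qed.

Lemma is_triform_mon d k : (forall i, (k i <= d i)%N) -> is_triform d (trimon d k).
Proof.
move=> le_kd; exists (fun a b c => (a == k (inord 0))%:R *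
  ((b == k (inord 1))%:R * (c == k (inord 2))%:R)) => t.
rewrite triform_evalE.
under eq_bigr => a _.
  under eq_bigr => b _.
    under eq_bigr => c _ do rewrite -!mulrA.
    rewrite -!big_distrr /=.
    rewrite (sum_delta (fun c => trimon d (exponents a b c) t)) ?ltnS //.
    over.
  rewrite -!big_distrr /=.
  rewrite (sum_delta (fun b => trimon d (exponents a b _) t)) ?ltnS //.
  over.
rewrite (sum_delta (fun a => trimon d (exponents a _ _) t)) ?ltnS //.
by apply: eq_bigr => i _; rewrite exponents_eta.
Qed.

Lemma is_triform_ext d G H : G =1 H -> is_triform d G -> is_triform d H.
Proof. by move=> e [co h]; exists co => t; rewrite -e. Qed.

Lemma trimonM d k d' k' t : (forall i, (k i <= d i)%N) ->
  (forall i, (k' i <= d' i)%N) ->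
  trimon d k t * trimon d' k' t =
  trimon (fun i => d i + d' i)%N (fun i => k i + k' i)%N t.
Proof.
move=> le_kd le_kd'; rewrite -big_split; apply: eq_bigr => i _ /=.
rewrite mulrACA -!exprD; congr (_ * _ ^+ _).
by rewrite addnBA // addnBAC // subnDA.
Qed.

Lemma exponents_le d a b c : (a < (d (inord 0)).+1)%N ->
  (b < (d (inord 1)).+1)%N -> (c < (d (inord 2)).+1)%N ->
  forall i, (exponents a b c i <= d i)%N.
Proof.
move=> ha hb hc i; rewrite -(exponents_eta d i).
by case: i => [[|[|[|]]]] //= ?; rewrite /exponents /=.
Qed.

(** Both factors expand into monomials, and a product of two monomials is a monomial of the summed
    tridegree. *)
Lemma is_triformM d d' G H : is_triform d G -> is_triform d' H ->
  is_triform (fun i => d i + d' i)%N (fun t => G t * H t).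
Proof.
move=> [co hG] [co' hH].
pose T := (\sum_(a < (d (inord 0)).+1) \sum_(b < (d (inord 1)).+1)
  \sum_(c < (d (inord 2)).+1) \sum_(a' < (d' (inord 0)).+1)
  \sum_(b' < (d' (inord 1)).+1) \sum_(c' < (d' (inord 2)).+1)
   (co a b c * co' a' b' c') * trimon (fun i => d i + d' i)%N
   (fun i => exponents a b c i + exponents a' b' c' i)%N (_ : 'I_3 -> P1 F)).
apply: (@is_triform_ext _ T); last first.
  do 6!apply: is_triform_sum => ? _; apply/is_triformZ/is_triform_mon => i.
  by rewrite leq_add ?exponents_le.
move=> t; rewrite hG hH !triform_evalE.
do 3!(rewrite big_distrl; apply: eq_bigr => ? _).
do 3!(rewrite big_distrr; apply: eq_bigr => ? _).
by rewrite /= mulrACA trimonM //; apply: exponents_le.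
Qed.

Lemma zclosedU (A B : set ('I_3 -> P1 F)) :
  zclosed A -> zclosed B -> zclosed (A `|` B).
Proof.
move=> [S ->] [T ->].
(* The products of an equation of A and an equation of B. *)
exists [set h | exists f g, [/\ S f, T g &
  forall t, triform_eval h t = triform_eval f t * triform_eval g t]].
apply/seteqP; split=> t /=.
  move=> hST h [f [g [Sf Tg ->]]].
  by case: hST => [/(_ _ Sf)|/(_ _ Tg)] ->; rewrite ?mul0r ?mulr0.
move=> hST; case: (pselect (forall f, S f -> triform_eval f t = 0)) => [|nS].
  by left.
right => g Tg; apply: contra_notP nS => /eqP gt f Sf; apply/eqP.
have [||co h] := @is_triformM (tridegree f) (tridegree g) (triform_eval f)
  (triform_eval g).
- by exists (tricoef f) => s; case: f {Sf}.
- by exists (tricoef g) => s; case: g {Tg gt}.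
have /eqP := hST (Triform _ co) (ex_intro _ f (ex_intro _ g
  (And3 Sf Tg (fun s => esym (h s))))).
by rewrite -h mulf_eq0 (negPf gt) orbF.
Qed.

(** The constant form 1 of tridegree 0 has no zeros. *)
Lemma zclosed0 : zclosed (set0 : set ('I_3 -> P1 F)).
Proof.
exists [set Triform (fun=> 0%N) (fun _ _ _ => 1)]; apply/seteqP; split=> t //=.
move/(_ _ erefl)/eqP; rewrite triform_evalE.
rewrite /= !big_ord1 mul1r /trimon big1 ?oner_eq0 //.
by move=> i _; rewrite sub0n expr0 mulr1 /exponents; case: i => [[|[|[|]]]].
Qed.

Lemma hcoord_eq (a b : P1 F) :
  (hcoord a).1 * (hcoord b).2 = (hcoord b).1 * (hcoord a).2 -> a = b.
Proof.
case: a b => [a|] [b|] //=; rewrite ?mulr1 ?mulr0 ?mul1r => e.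
- by rewrite e.
- by move/esym/eqP: e; rewrite oner_eq0.
- by move/eqP: e; rewrite oner_eq0.
Qed.

(** The equation is the 2 by 2 determinant of the homogeneous coordinates of [t i] and [a]. *)
Lemma zclosed_coord (i : 'I_3) (a : P1 F) : zclosed [set t | t i = a].
Proof.
pose e (k : nat) : 'I_3 -> nat := fun j => if j == i then k else 0%N.
have mon (k : nat) t : trimon (e 1%N) (e k) t =
    (hcoord (t i)).1 ^+ k * (hcoord (t i)).2 ^+ (1 - k).
  rewrite /trimon (bigD1 i) //= /e eqxx big1 ?mulr1 //.
  by move=> j /negPf ->; rewrite mulr1.
have [|co h] := @is_triform_sum (e 1%N) bool [:: true; false] xpredT
  (fun b t => (if b then (hcoord a).2 else - (hcoord a).1) * trimon (e 1%N) (e b) t).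
  move=> b _; apply/is_triformZ/is_triform_mon => j.
  by rewrite /e; case: (j == i); case: b.
have {}h t : triform_eval (Triform (e 1%N) co) t =
    (hcoord (t i)).1 * (hcoord a).2 - (hcoord a).1 * (hcoord (t i)).2.
  rewrite -h !big_cons big_nil addr0 /= !mon subnn subn0 !expr0 !expr1.
  by rewrite mulr1 mul1r mulNr mulrC.
exists [set Triform (e 1%N) co]; apply/seteqP; split=> t /=.
  by move=> ta f ->; rewrite h ta subrr.
by move/(_ _ erefl)/eqP; rewrite h subr_eq0 => /eqP/hcoord_eq.
Qed.

(** The sets [t i = a] are closed. An irreducible set covered by finitely many of them lies in one,
    which would make a coordinate constant. *)
Lemma zirreducible_avoid (A : set ('I_3 -> P1 F))
    (s : seq ('I_3 * P1 F)) : zirreducible A ->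
  (forall i, ~ exists a, forall t, A t -> t i = a) ->
  exists2 t, A t & forall p, p \in s -> t p.1 != p.2.
Proof.
move=> [[t0 At0] irrA] ncst.
pose B (s : seq ('I_3 * P1 F)) : set ('I_3 -> P1 F) :=
  [set t | exists2 p, p \in s & t p.1 = p.2].
have BE p s' : B (p :: s') = [set t | t p.1 = p.2] `|` B s'.
  apply/seteqP; split=> t /=.
    by move=> [q]; rewrite inE => /predU1P[->|]; [left|right; exists q].
  by move=> [?|[q qs ?]]; [exists p; rewrite ?mem_head|exists q; rewrite // inE qs orbT].
have clB s' : zclosed (B s').
  elim: s' => [|p s' IH]; last by rewrite BE; exact/zclosedU/IH/zclosed_coord.
  by have -> : B [::] = set0; [apply/seteqP; split=> t // -[]|exact: zclosed0].
have nsub : ~ A `<=` B s.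
  elim: s => [/(_ _ At0)[]//|p s IH]; rewrite BE => /irrA.
  case/(_ (zclosed_coord _ _) (clB s)) => // sub.
  by apply: (ncst p.1); exists p.2 => t /sub.
case: (pselect (exists2 t, A t & ~ B s t)) => [[t At nBt]|nex].
  by exists t => // p ps; apply/eqP => e; apply: nBt; exists p.
by case: nsub => t At; apply: contrapT => nBt; apply: nex; exists t.
Qed.

(** The Zariski closure, cut out by all forms vanishing on [A]. *)
Definition zcl (A : set ('I_3 -> P1 F)) : set ('I_3 -> P1 F) :=
  [set t | forall f, (forall s, A s -> triform_eval f s = 0) -> triform_eval f t = 0].

Lemma zclosed_zcl A : zclosed (zcl A).
Proof. by exists [set f | forall s, A s -> triform_eval f s = 0]. Qed.

Lemma sub_zcl A : A `<=` zcl A.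
Proof. by move=> t At f; apply. Qed.

Lemma zcl_min A B : zclosed B -> A `<=` B -> zcl A `<=` B.
Proof. by move=> [S ->] AB t clt f Sf; apply: clt => s /AB /(_ f Sf). Qed.

End Triforms.

(** * The closure equation and the lambda-matrix *)

Section Rotation.
Variables (F : fieldType) (A : algType F).
Implicit Types (h : A) (x : F).

Lemma fac_sub_add x h : h ^+ 2 = -1 -> (x%:A - h) * (x%:A + h) = (x ^+ 2 + 1)%:A.
Proof.
move=> hh; have c : x%:A * h = h * x%:A by rewrite mulr_algl mulr_algr.
rewrite mulrBl !mulrDr c opprD addrA addrK -!expr2 hh opprK.
by rewrite scalerDl scale1r !expr2 mulr_algl scalerA.
Qed.

Lemma fac_add_sub x h : h ^+ 2 = -1 -> (x%:A + h) * (x%:A - h) = (x ^+ 2 + 1)%:A.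
Proof. by move=> hh; rewrite -{1}[h]opprK fac_sub_add // sqrrN. Qed.

(* Moving the first factor of each side to the other end by means of
   (t + h)(t - h) = t^2 + 1 produces the next row of the lambda-matrix. *)
Lemma closure_rot (u v w p q s u' s' : A) (n : F) : n != 0 ->
  u * v * w = p * q * s -> u' * u = n%:A -> s * s' = n%:A ->
  v * w * s' = u' * p * q.
Proof.
move=> n0 e eu es; apply: (scalerI n0).
rewrite -mulr_algl -eu !mulrA -(mulrA _ u) -(mulrA _ (u * v)) e.
by rewrite -!mulrA es mulr_algr -!scalerAr !mulrA.
Qed.

Lemma fac_telescope (u v w u' v' w' : A) (a b c : F) :
  u * u' = a%:A -> v * v' = b%:A -> w * w' = c%:A ->
  w * v * u * u' * v' * w' = (c * b * a)%:A.
Proof.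
move=> eu ev ew; rewrite -(mulrA _ u) eu mulr_algr -!scalerAl.
rewrite -(mulrA _ v) ev mulr_algr -scalerAl ew !scalerA.
by congr (_ *: _); ring.
Qed.
End Rotation.

Section ClosureSum.
Variables (F : fieldType) (V : lmodType F).

(** The pairing of the monomials with one row of the lambda-matrix, the arguments being the row
    entries in column order. *)
Definition closure_sum (x y z : F) (g3 g2 g1 p q r s : V) : V :=
  (x * y) *: g3 + (x * z) *: g2 + (y * z) *: g1 + z *: p + y *: q + x *: r + s.

Lemma closure_sum_rot (x y z : F) (g3 g2 g1 p q r s : V) :
  closure_sum y z x g3 g2 g1 p q r s = closure_sum x y z g2 g1 g3 q r p s.
Proof.
rewrite /closure_sum [y * x]mulrC [z * x]mulrC; congr (_ + s).
by rewrite [LHS](ACl (2*3*1*5*6*4))%AC.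
Qed.
End ClosureSum.

Section Closure.
Variable F : fieldType.
Local Notation DH := (dualquat F).
Implicit Types (h : DH) (x : F) (L : 6.-tuple DH).

(** The cubic terms xyz cancel, which leaves the seven monomials that index the columns of the
    lambda-matrix. *)
Lemma closure_expand (x y z : F) (a b c a' b' c' : DH) :
  (x%:A - a) * (y%:A - b) * (z%:A - c) - (z%:A + c') * (y%:A + b') * (x%:A + a')
  = - (closure_sum x y z (c + c') (b + b') (a + a') (b' * a' - a * b)
      (c' * a' - a * c) (c' * b' - b * c) (c' * b' * a' + a * b * c)).
Proof.
rewrite /closure_sum.
rewrite !(mulrDl, mulrDr, mulr_algl, mulr_algr, mulNr, mulrN, opprK,
  =^~ scalerAl, =^~ scalerAr).
rewrite !(mulr_algl, mulr_algr, mulNr, mulrN, opprK, =^~ scalerAl,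
  =^~ scalerAr, scalerA, mul1r, mulr1, opprD, scalerDr, scalerN).
(* With the noncommutative products turned into atoms, the identity is linear in them and can be
   checked coordinatewise in the field. *)
move: (c' * b' * a') (a * b * c) (b' * a') (c' * a') (c' * b') (a * b) (a * c) (b * c).
move=> ? ? ? ? ? ? ? ?; apply/rowP => k; rewrite !mxE.
move: ((1 : DH) 0 k) => ?. ring.
Qed.

Definition monomials (x y z : F) : 'rV[F]_7 :=
  \row_(j < 7) [:: x * y; x * z; y * z; z; y; x; 1]`_j.

Lemma closure_expand_eq0 (x y z : F) (a b c a' b' c' : DH) :
  (x%:A - a) * (y%:A - b) * (z%:A - c) = (z%:A + c') * (y%:A + b') * (x%:A + a')
  <-> closure_sum x y z (c + c') (b + b') (a + a') (b' * a' - a * b)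
      (c' * a' - a * c) (c' * b' - b * c) (c' * b' * a' + a * b * c) = 0.
Proof.
split=> [/eqP|e]; first by rewrite -subr_eq0 closure_expand oppr_eq0 => /eqP.
by apply/eqP; rewrite -subr_eq0 closure_expand e oppr0.
Qed.

Definition symmetric_closure L (x y z : F) : Prop :=
  (x%:A - L`_0) * (y%:A - L`_1) * (z%:A - L`_2) =
  (z%:A + L`_5) * (y%:A + L`_4) * (x%:A + L`_3).

Lemma lambda_matrix_sum L (i : 'I_6) (x y z : F) :
  \sum_(j < 7) monomials x y z 0 j *: lambda_matrix L i j =
  let M j := lambda_matrix L i (inord j) in
  closure_sum x y z (M 0%N) (M 1%N) (M 2%N) (M 3%N) (M 4%N) (M 5%N) (M 6%N).
Proof.
rewrite !big_ord_recr big_ord0 /= add0r /closure_sum.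
do 6?[congr (_ + _)]; last rewrite -[RHS]scale1r.
all: by congr (_ *: lambda_matrix L i _); [rewrite mxE|apply: val_inj; rewrite /= inordK].
Qed.

Lemma symmetric_closureE L (x y z : F) :
  symmetric_closure L x y z <->
  \sum_(j < 7) monomials x y z 0 j *: lambda_matrix L ord0 j = 0.
Proof.
by rewrite /symmetric_closure closure_expand_eq0 lambda_matrix_sum /= !mxE !inordK.
Qed.

Lemma linkage_sqr L (i : nat) : linkage6R L -> (i < 6)%N -> L`_i ^+ 2 = -1.
Proof.
by move=> hL lt_i; have := hL (Ordinal lt_i); rewrite (tnth_nth 0).
Qed.

(** Row [i] expands the closure equation after [i] rotations. Each rotation cancels a factor t^2+1,
    which must therefore be nonzero. *)
Lemma lambda_matrix_closure L (x y z : F) : linkage6R L ->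
  x ^+ 2 + 1 != 0 -> y ^+ 2 + 1 != 0 -> z ^+ 2 + 1 != 0 ->
  symmetric_closure L x y z -> forall i : 'I_6,
  \sum_(j < 7) monomials x y z 0 j *: lambda_matrix L i j = 0.
Proof.
move=> hL x0 y0 z0 e1.
have sq i : (i < 6)%N -> L`_i ^+ 2 = -1 by exact: linkage_sqr.
have e2 := closure_rot x0 e1 (fac_add_sub x (sq 0%N isT)) (fac_add_sub x (sq 3%N isT)).
have e3 := closure_rot y0 e2 (fac_add_sub y (sq 1%N isT)) (fac_add_sub y (sq 4%N isT)).
have e4 := closure_rot z0 e3 (fac_add_sub z (sq 2%N isT)) (fac_add_sub z (sq 5%N isT)).
have e5 := closure_rot x0 e4 (fac_add_sub x (sq 3%N isT)) (fac_add_sub x (sq 0%N isT)).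
have e6 := closure_rot y0 e5 (fac_add_sub y (sq 4%N isT)) (fac_add_sub y (sq 1%N isT)).
move/closure_expand_eq0: e1 => e1; move/closure_expand_eq0: e2 => e2.
move/closure_expand_eq0: e3 => e3; move/closure_expand_eq0: e4 => e4.
move/closure_expand_eq0: e5 => e5; move/closure_expand_eq0: e6 => e6.
(* The rotated equations have their variables in the order (y, z, x) or (z, x, y); the order (x, y,
   z) is restored. *)
rewrite closure_sum_rot in e2; rewrite -closure_sum_rot in e3.
rewrite closure_sum_rot in e5; rewrite -closure_sum_rot in e6.
move=> i; rewrite lambda_matrix_sum /= !mxE !inordK //.
have g1 := addrC L`_3 L`_0; have g2 := addrC L`_4 L`_1; have g3 := addrC L`_5 L`_2.
rewrite ?g1 ?g2 ?g3 in e2 e3 e4 e5 e6.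
case: i => [[|[|[|[|[|[|]]]]]]] //= _.
Qed.

(** Once the first three factors are replaced by the right-hand side of the closure equation, the
    product of six collapses from the middle to (z^2+1)(y^2+1)(x^2+1). *)
Lemma Ksym_closure L (x y z : F) (t : 'I_3 -> P1 F) : linkage6R L ->
  t (inord 0) = Some x -> t (inord 1) = Some y -> t (inord 2) = Some z ->
  x ^+ 2 + 1 != 0 -> y ^+ 2 + 1 != 0 -> z ^+ 2 + 1 != 0 ->
  symmetric_closure L x y z -> Ksym L t.
Proof.
move=> hL tx ty tz x0 y0 z0 e.
exists ((z ^+ 2 + 1) * (y ^+ 2 + 1) * (x ^+ 2 + 1)); first by rewrite !mulf_neq0.
rewrite !big_ord_recr big_ord0 /= mul1r !(tnth_nth 0) /= tx ty tz /= e.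
by apply: fac_telescope; rewrite fac_add_sub // linkage_sqr.
Qed.
End Closure.

(** * Rank of the coordinate matrix *)

Section Rank.
Variable F : fieldType.

Lemma coord_matrixE (m n : nat) (M : 'M[dualquat F]_(m, n)) a j :
  coord_matrix M a j = M (tagnat.sig1 a) j 0 (tagnat.sig2 a).
Proof. by rewrite !mxE. Qed.

Lemma coord_matrix_Rank (m n : nat) (M : 'M[dualquat F]_(m, n)) i j k :
  coord_matrix M (tagnat.Rank i k) j = M i j 0 k.
Proof.
have /matrixP/(_ k j) : submxcol (coord_matrix M) i = \matrix_(k, j) M i j 0 k.
  exact: mxcolK.
by rewrite !mxE.
Qed.

Lemma coord_matrix_mulmx_eq0 (m n p : nat) (M : 'M[dualquat F]_(m, n))
    (v : 'M[F]_(n, p)) :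
  (forall i k, \sum_j v j k *: M i j = 0) -> coord_matrix M *m v = 0.
Proof.
move=> Mv; apply/matrixP => a k; rewrite !mxE.
have /rowP/(_ (tagnat.sig2 a)) := Mv (tagnat.sig1 a) k.
rewrite summxE !mxE => e; rewrite -[RHS]e; apply: eq_bigr => j _.
by rewrite coord_matrixE !mxE mulrC.
Qed.

Lemma rank_le1P (m n : nat) (A : 'M[F]_(m, n)) : (\rank A <= 1)%N ->
  A = 0 \/ exists (u : 'cV[F]_m) (w : 'rV[F]_n), A = u *m w.
Proof.
move=> rA; have [->|/rowV0Pn[w wA w0]] := eqVneq A 0; [by left|right].
have [_] := mxrank_leqif_sup wA.
rewrite rank_rV w0 eqn_leq rA lt0n mxrank_eq0 andbT.
have -> : A != 0 by apply: contra_neq w0 => A0; move: wA; rewrite A0 => /submx0null.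
by move=> /esym/submxP[u ->]; exists u, w.
Qed.

(** The columns of xy, y, x and 1 already make the three rows independent. *)
Lemma monomials_rank (p q r : 'I_3 -> F) (i0 := inord 0) (i1 := inord 1) :
  p i0 != q i0 -> p i0 != r i0 -> q i0 != r i0 -> p i1 != q i1 ->
  \rank (\matrix_(i < 3, j < 7) (let t := nth p [:: p; q; r] i in
    monomials (t i0) (t i1) (t (inord 2)) 0 j)) = 3%N.
Proof.
move=> pq0 pr0 qr0 pq1; apply/eqP; apply: inj_row_free => u uV.
have E (j : 'I_7) : \sum_(i < 3) u 0 i * (let t := nth p [:: p; q; r] i in
    monomials (t i0) (t i1) (t (inord 2)) 0 j) = 0.
  have /rowP/(_ j) := uV; rewrite !mxE => e; rewrite -[RHS]e.
  by apply: eq_bigr => i _; rewrite !mxE.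
have := E (inord 6); have := E (inord 5); have := E (inord 4); have := E (inord 0).
rewrite !big_ord_recr !big_ord0 /= !mxE !inordK //= !add0r !mulr1.
set a := u 0 _; set b := u 0 _; set c := u 0 _.
move=> e1 e2 e3 e4.
have c0 : c = 0.
  (* The functions (x - p0)(y - q1) and (x - q0)(y - p1) vanish at [p] and [q], so pairing with them
     isolates [c]. Weighting the two results by r0 - q0 and r0 - p0 and subtracting eliminates
     r1. *)
  apply/eqP; have : (p i0 - r i0) * (q i0 - r i0) * (p i1 - q i1) * c == 0.
    apply/eqP; transitivity
      ((r i0 - q i0) * ((a * (p i0 * p i1) + b * (q i0 * q i1) + c * (r i0 * r i1))
        - p i0 * (a * p i1 + b * q i1 + c * r i1)
        - q i1 * ((a * p i0 + b * q i0 + c * r i0) - p i0 * (a + b + c)))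
      - (r i0 - p i0) * ((a * (p i0 * p i1) + b * (q i0 * q i1) + c * (r i0 * r i1))
        - q i0 * (a * p i1 + b * q i1 + c * r i1)
        - p i1 * ((a * p i0 + b * q i0 + c * r i0) - q i0 * (a + b + c)))).
      ring.
    by rewrite e1 e2 e3 e4 !mulr0 !subrr !mulr0 !subrr !mulr0 subrr.
  by rewrite !mulf_eq0 !subr_eq0 (negPf pr0) (negPf qr0) (negPf pq1).
have a0 : a = 0.
  apply/eqP; have : (p i0 - q i0) * a == 0.
    apply/eqP; transitivity ((a * p i0 + b * q i0 + c * r i0) - q i0 * (a + b + c)
      + c * (q i0 - r i0)); first by ring.
    by rewrite e3 e4 c0 mul0r mulr0 !addr0 subrr.
  by rewrite mulf_eq0 subr_eq0 (negPf pq0).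
have b0 : b = 0 by move: e4; rewrite a0 c0 add0r addr0.
apply/rowP => i; rewrite mxE -[RHS]b0.
case: i => [[|[|[|]]]] //= lt_i.
- by rewrite b0 -a0; congr (u 0 _); apply: val_inj.
- by congr (u 0 _); apply: val_inj.
- by rewrite b0 -c0; congr (u 0 _); apply: val_inj.
Qed.
End Rank.

(** * Dimension of sets containing a rational surface *)

Section Parametrization.
Variable F : closedFieldType.
Implicit Types (p q Delta : {poly {poly F}}) (w : F * F) (W : set (F * F)).

(** Bivariate polynomials are nested: [w.1] goes into the coefficients, [w.2] into the outer
    variable. *)
Definition peval w p : F := (map_poly (horner_eval w.1) p).[w.2].

Lemma pevalM w p q : peval w (p * q) = peval w p * peval w q.
Proof. by rewrite /peval rmorphM hornerM. Qed.

Lemma pevalD w p q : peval w (p + q) = peval w p + peval w q.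
Proof. by rewrite /peval rmorphD hornerD. Qed.

Lemma pevalXn w p n : peval w (p ^+ n) = peval w p ^+ n.
Proof. by rewrite /peval rmorphXn horner_exp. Qed.

Lemma pevalN w p : peval w (- p) = - peval w p.
Proof. by rewrite /peval rmorphN hornerN. Qed.

Lemma peval0 w : peval w 0 = 0.
Proof. by rewrite /peval rmorph0 horner0. Qed.

Lemma peval1 w : peval w 1 = 1.
Proof. by rewrite /peval rmorph1 hornerC. Qed.

Lemma pevalX w : peval w 'X = w.2.
Proof. by rewrite /peval map_polyX hornerX. Qed.

Lemma pevalC w (r : {poly F}) : peval w r%:P = r.[w.1].
Proof. by rewrite /peval map_polyC hornerC. Qed.

Lemma peval_sum w (I : Type) (r : seq I) (P : pred I) (p : I -> {poly {poly F}}) :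
  peval w (\sum_(i <- r | P i) p i) = \sum_(i <- r | P i) peval w (p i).
Proof. by rewrite /peval rmorph_sum horner_sum. Qed.

(* Irreducibility of W in the form: nonempty open subsets of W meet. *)
Definition irreducible_params W :=
  forall p q w w', W w -> W w' -> peval w p != 0 -> peval w' q != 0 ->
  exists2 w'', W w'' & peval w'' p * peval w'' q != 0.

Lemma closed_nonroot (p : {poly F}) : p != 0 -> exists x, p.[x] != 0.
Proof. by move/closed_nonrootP => [x]; exists x. Qed.

Lemma peval_nonroot p : p != 0 -> exists w, peval w p != 0.
Proof.
move=> p0; have [i pi0] : exists i, p`_i != 0.
  by exists (size p).-1; rewrite -lead_coefE lead_coef_eq0.
have [x px] := closed_nonroot pi0.
have [|y hy] := @closed_nonroot (map_poly (horner_eval x) p).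
  by apply: contraNneq px => /polyP/(_ i); rewrite coef_map coef0 /= => /eqP.
by exists (x, y).
Qed.

Lemma peval_neq0 w p : peval w p != 0 -> p != 0.
Proof. by apply: contraNneq => ->; rewrite peval0. Qed.

(** The product of [Delta], [p] and [q] is nonzero in a domain, hence has a nonroot over an
    algebraically closed field. *)
Lemma irreducible_params_open Delta :
  irreducible_params [set w | peval w Delta != 0].
Proof.
move=> p q w w' /= dw _ pw qw'.
have [|v] := @peval_nonroot (Delta * (p * q)).
  by rewrite !mulf_neq0 // ?(peval_neq0 dw) ?(peval_neq0 pw) ?(peval_neq0 qw').
by rewrite !pevalM mulf_eq0 negb_or => /andP[]; exists v.
Qed.

(** The same argument in one variable, after the first coordinate is set to [x0]. *)
Lemma irreducible_params_line Delta x0 :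
  irreducible_params [set w | w.1 = x0 /\ peval w Delta != 0].
Proof.
move=> p q [x w] [x' w'] /= [-> dw] [-> _] pw qw'.
pose s := map_poly (horner_eval x0).
have nz y r : peval (x0, y) r != 0 -> s r != 0.
  by apply: contraNneq; rewrite /peval -/(s r) /= => ->; rewrite horner0.
have [|v] := @closed_nonroot (s Delta * (s p * s q)).
  by rewrite !mulf_neq0 // ?(nz _ _ dw) ?(nz _ _ pw) ?(nz _ _ qw').
by rewrite !hornerM mulf_eq0 negb_or => /andP[dv pqv]; exists (x0, v).
Qed.

Lemma irreducible_params1 w : irreducible_params [set w].
Proof. by move=> p q v v' -> -> pw qw; exists w => //; rewrite mulf_neq0. Qed.

Variables N D : 'I_3 -> {poly {poly F}}.

Definition param w : 'I_3 -> P1 F := fun i => Some (peval w (N i) / peval w (D i)).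

(* Substituting the fractions N i / D i and clearing denominators. *)
Definition pullback (f : triform F) : {poly {poly F}} :=
  \sum_(a < (tridegree f (inord 0)).+1) \sum_(b < (tridegree f (inord 1)).+1)
    \sum_(c < (tridegree f (inord 2)).+1) (tricoef f a b c)%:P%:P *
    \prod_(i < 3) (N i ^+ exponents a b c i * D i ^+ (tridegree f i - exponents a b c i)).

Lemma peval_pullback f w : (forall i, peval w (D i) != 0) ->
  peval w (pullback f) =
  (\prod_(i < 3) peval w (D i) ^+ tridegree f i) * triform_eval f (param w).
Proof.
move=> D0; case: f => d co; rewrite triform_evalE /pullback /=.
rewrite peval_sum big_distrr; apply: eq_bigr => a _ /=.
rewrite peval_sum big_distrr; apply: eq_bigr => b _ /=.
rewrite peval_sum big_distrr; apply: eq_bigr => c _ /=.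
rewrite pevalM !pevalC hornerC mulrCA; congr (_ * _).
rewrite (big_morph (peval w) (@pevalM w) (peval1 w)) -big_split.
apply: eq_bigr => i _ /=; rewrite expr1n mulr1 pevalM !pevalXn.
have le : (exponents a b c i <= d i)%N by exact: exponents_le.
rewrite expr_div_n mulrCA; congr (_ * _).
by rewrite -[X in _ = _ ^+ X / _](subnK le) exprD mulfK // expf_neq0.
Qed.

Lemma triform_param_eq0 f w : (forall i, peval w (D i) != 0) ->
  (triform_eval f (param w) == 0) = (peval w (pullback f) == 0).
Proof.
move=> D0; rewrite peval_pullback // mulf_eq0 prodf_seq_eq0.
case: hasP => // -[i _] /=; rewrite expf_eq0 => /andP[_].
by rewrite (negPf (D0 i)).
Qed.

(** If neither closed set contains the image, each has a form whose pullback is nonzero somewhere on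
    [W]. A common nonzero of both pullbacks gives a point outside both sets. *)
Lemma zirreducible_param X W : W !=set0 -> irreducible_params W ->
  (forall w i, W w -> peval w (D i) != 0) -> (forall w, W w -> X (param w)) ->
  zirreducible (X `&` zcl (param @` W)).
Proof.
move=> [w0 Ww0] irrW D0 WX; have sub : param @` W `<=` X `&` zcl (param @` W).
  by move=> _ [w Ww <-]; split; [exact: WX|apply: sub_zcl; exists w].
split; first by exists (param w0); apply: sub; exists w0.
move=> C E clC clE cov.
case: (pselect (param @` W `<=` C)) => [WC|nWC].
  by left => t [_]; exact: zcl_min.
case: (pselect (param @` W `<=` E)) => [WE|nWE].
  by right => t [_]; exact: zcl_min.
have sep B : zclosed B -> ~ param @` W `<=` B -> exists f w,
    [/\ forall t, B t -> triform_eval f t = 0, W w & peval w (pullback f) != 0].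
  move=> [S ->] nWB; apply: contra_notP nWB => nex _ [w Ww <-] f Sf.
  apply/eqP; rewrite triform_param_eq0; last by move=> i; exact: D0.
  apply: contrapT => /negP fw; apply: nex; exists f, w; split=> // t; exact.
have [f [w [fC Ww fw]]] := sep _ clC nWC.
have [g [w' [gE Ww' gw']]] := sep _ clE nWE.
have [v Wv] := irrW _ _ _ _ Ww Ww' fw gw'.
have Dv i : peval v (D i) != 0 by exact: D0.
rewrite mulf_eq0 -!triform_param_eq0 //.
have [] := cov (param v); first by apply: sub; exists v.
  by move=> /fC ->; rewrite eqxx.
by move=> /gE ->; rewrite eqxx orbT.
Qed.

Lemma zdim_ge2_param X Delta w0 (i j : 'I_3) : peval w0 Delta != 0 ->
  (forall w k, peval w Delta != 0 -> peval w (D k) != 0) ->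
  (forall w, peval w Delta != 0 -> X (param w)) ->
  (forall w, param w i = Some w.1) -> (forall w, param w j = Some w.2) ->
  zdim_ge X 2.
Proof.
move=> d0 D0 UX parami paramj.
(* The chain: the images of the point w0, of the line w.1 = w0.1 and of the
   plane, each deprived of the zeros of Delta. *)
pose W (n : nat) : set (F * F) := match n with
  | 0%N => [set w0]
  | 1%N => [set w | w.1 = w0.1 /\ peval w Delta != 0]
  | _ => [set w | peval w Delta != 0] end.
have Ww0 n : W n w0 by case: n => [|[|n]].
have WU n w : W n w -> peval w Delta != 0 by case: n => [|[|n]] /= => [->|[]|].
have irrW n : irreducible_params (W n).
  case: n => [|[|n]]; [exact: irreducible_params1|exact: irreducible_params_line|].
  exact: irreducible_params_open.
have WS n : W n `<=` W n.+1.
  by case: n => [|[|n]] w //= => [->|[]].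
exists (fun n => X `&` zcl (param @` W n)); split=> [n _|n n2].
  split; first by exists (zcl (param @` W n)) => //; exact: zclosed_zcl.
  apply: zirreducible_param => //; first by exists w0.
  - by move=> w k /WU; exact: D0.
  - by move=> w /WU; exact: UX.
split.
  move=> t [Xt clt]; split=> // f f0; apply: clt => _ [w Ww <-].
  by apply: f0; exists w => //; exact: WS.
(* For strictness it suffices that some coordinate is constant on one piece and not on the next, as
   the constancy passes to the closure. *)
suff [k [a [W_a [w Ww nwa]]]] : exists k a, (forall w, W n w -> param w k = Some a) /\
    exists2 w, W n.+1 w & param w k <> Some a.
  move=> sub; have [] := sub (param w).
    split; first by apply: UX; exact: WU Ww.
    by apply: sub_zcl; exists w.
  move=> _ clw; apply: nwa.
  apply: (zcl_min (zclosed_coord k (Some a)) _ clw).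
  by move=> _ [v Wv <-]; exact: W_a.
(* Coordinate [j] is fixed at the point but moves along the line; [i] is fixed on the line but moves
   in the plane. A nonroot of [Delta] times a linear factor shows the movement. *)
case: n n2 => [|[|//]] _; [exists j, w0.2|exists i, w0.1].
  split=> [_ ->|]; first by rewrite paramj.
  pose s := map_poly (horner_eval w0.1) Delta.
  have s0 : s != 0.
    by apply: contraNneq d0; rewrite /peval -/s => ->; rewrite horner0.
  have [|v] := @closed_nonroot (s * ('X - w0.2%:P)).
    by rewrite mulf_neq0 // polyXsubC_eq0.
  rewrite hornerM mulf_eq0 negb_or hornerXsubC subr_eq0 => /andP[sv vw0].
  by exists (w0.1, v) => //; rewrite paramj => -[/= e]; rewrite e eqxx in vw0.
split=> [w [<- _]|]; first by rewrite parami.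
have [|v] := @peval_nonroot (Delta * ('X - w0.1%:P)%:P).
  by rewrite mulf_neq0 ?(peval_neq0 d0) // polyC_eq0 polyXsubC_eq0.
rewrite pevalM mulf_eq0 negb_or pevalC hornerXsubC subr_eq0 => /andP[dv vw0].
by exists v => //; rewrite parami => -[e]; rewrite e eqxx in vw0.
Qed.
End Parametrization.

(** * Extension of scalars for dual quaternions *)

Section ScalarExtension.
Variables (F F' : comNzRingType) (f : {rmorphism F -> F'}).

Lemma map_quatM (p q : quat F) :
  map_mx f (p * q) = (map_mx f p : quat F') * (map_mx f q : quat F') :> quat F'.
Proof.
rewrite !quat_mulE; apply: quatP => -[|[|[|[|]]]] // _.
all: rewrite /quat_mul !mxE !inordK //=.
all: by rewrite !(rmorphD, rmorphN, rmorphM).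
Qed.

Lemma map_quat1 : map_mx f (1 : quat F) = (1 : quat F') :> quat F'.
Proof.
by apply: quatP => -[|[|[|[|]]]] // _; rewrite !mxE !inordK //= ?rmorph1 ?rmorph0.
Qed.

Definition map_dq (x : dualquat F) : dualquat F' := map_mx f x.

Lemma map_dqM x y : map_dq (x * y) = map_dq x * map_dq y.
Proof.
rewrite !dualquat_mulE /dualquat_mul /map_dq map_row_mx /primal /dual.
by rewrite !map_mxD -!map_lsubmx -!map_rsubmx !map_quatM.
Qed.

Lemma map_dqD x y : map_dq (x + y) = map_dq x + map_dq y.
Proof. exact: map_mxD. Qed.

Lemma map_dqN x : map_dq (- x) = - map_dq x.
Proof. exact: map_mxN. Qed.

Lemma map_dq1 : map_dq 1 = 1.
Proof. by rewrite /map_dq map_row_mx map_quat1 map_mx0. Qed.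
End ScalarExtension.

Section Complexification.
Variable R : rcfType.
Local Notation dq_complex := (map_dq (real_complex R)).

Lemma complexifyE (L : 6.-tuple (dualquat R)) (i : nat) :
  (i < 6)%N -> (complexify L)`_i = dq_complex L`_i.
Proof. by move=> lt_i; rewrite (nth_map 0) // size_tuple. Qed.

Lemma linkage6R_complexify (L : 6.-tuple (dualquat R)) :
  linkage6R L -> linkage6R (complexify L).
Proof.
by move=> hL i; rewrite tnth_map expr2 -map_dqM -expr2 hL map_dqN map_dq1.
Qed.

Lemma lambda_matrix_complexify (L : 6.-tuple (dualquat R)) j :
  lambda_matrix (complexify L) ord0 j = dq_complex (lambda_matrix L ord0 j).
Proof.
case: j => [[|[|[|[|[|[|[|]]]]]]]] //= lt_j; rewrite !mxE /= !complexifyE //.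
all: by rewrite !(map_dqD, map_dqN, map_dqM).
Qed.
End Complexification.

(** * Complex surfaces given as graphs with real coefficients *)

Section Graph.
Variables (R : realFieldType) (K : closedFieldType) (f : {rmorphism R -> K}).

Lemma sqr_ratio (a b : K) : a != 0 ->
  (- b / a) ^+ 2 + 1 = (a ^+ 2 + b ^+ 2) / a ^+ 2.
Proof. by move=> a0; rewrite mulrDl mulfV ?expf_neq0 // expr_div_n sqrrN addrC. Qed.

Lemma ratio_root (a b : K) : a != 0 -> a * (- b / a) + b = 0.
Proof. by move=> a0; rewrite mulrC mulfVK // addNr. Qed.

(** The equation A z + B = 0 is solved by z = -B/A, so (x, y) parametrizes a surface in [X] wherever
    [Delta] is nonzero. *)
Lemma zdim_ge2_graph (X : set ('I_3 -> P1 K)) (i j k : 'I_3)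
    (a b c d e h g : R) : i != j -> k != i -> k != j ->
  [|| a != 0, b != 0 | c != 0] ->
  (forall t (x y z : K), t i = Some x -> t j = Some y -> t k = Some z ->
     x ^+ 2 + 1 != 0 -> y ^+ 2 + 1 != 0 -> z ^+ 2 + 1 != 0 ->
     (f a * x + f b * y + f c) * z +
     (f d * x * y + f e * x + f h * y + f g) = 0 -> X t) ->
  zdim_ge X 2.
Proof.
move=> ij ki kj abc HX.
pose x : {poly {poly K}} := 'X%:P; pose y : {poly {poly K}} := 'X.
pose C (r : R) : {poly {poly K}} := (f r)%:P%:P.
pose A := C a * x + C b * y + C c.
pose B := C d * x * y + C e * x + C h * y + C g.
pose N m := if m == i then x else if m == j then y else - B.
pose D m := if m == k then A else 1.
pose Delta := A * ((x ^+ 2 + 1) * (y ^+ 2 + 1) * (A ^+ 2 + B ^+ 2)).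
have evC w r : peval w (C r) = f r by rewrite pevalC hornerC.
have evx w : peval w x = w.1 by rewrite pevalC hornerX.
have evy w : peval w y = w.2 by rewrite pevalX.
(* At a real point with A nonzero, x^2+1, y^2+1 and A^2+B^2 are positive, so [Delta] does not vanish
   there. *)
have [x0 [y0 A0]] : exists x0 y0 : R, a * x0 + b * y0 + c != 0.
  have [c0|] := eqVneq c 0; last by exists 0, 0; rewrite !mulr0 !add0r.
  have [a0|] := eqVneq a 0; last by exists 1, 0; rewrite c0 mulr0 !addr0 mulr1.
  exists 0, 1; rewrite mulr0 add0r mulr1 c0 addr0.
  by move: abc; rewrite a0 c0 eqxx orbF.
pose E := (pevalD, pevalM, pevalXn, pevalN, peval1, evC, evx, evy).
have Di w m : peval w Delta != 0 -> peval w (D m) != 0.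
  rewrite /D; case: (m == k); last by rewrite peval1 oner_eq0.
  by rewrite pevalM mulf_eq0 negb_or => /andP[].
have pi_ w : param N D w i = Some w.1.
  by rewrite /param /N /D eqxx eq_sym (negPf ki) evx peval1 divr1.
have pj w : param N D w j = Some w.2.
  by rewrite /param /N /D eqxx !(eq_sym j) (negPf ij) (negPf kj) evy peval1 divr1.
have pk w : param N D w k = Some (- peval w B / peval w A).
  by rewrite /param /N /D eqxx (negPf ki) (negPf kj) pevalN.
apply: (@zdim_ge2_param _ N D X Delta (f x0, f y0) i j) => //.
  rewrite /Delta /A /B !E /= -(rmorph1 f) -!(rmorphXn, rmorphM, rmorphD) fmorph_eq0.
  rewrite !mulf_neq0 // gt_eqF //.
  - by rewrite ltr_pwDr ?ltr01 ?sqr_ge0.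
  - by rewrite ltr_pwDr ?ltr01 ?sqr_ge0.
  - by rewrite ltr_pwDl ?sqr_ge0 // exprn_even_gt0.
move=> w dw; have := dw.
rewrite /Delta 3!pevalM !mulf_eq0 !negb_or => /andP[A1 /andP[/andP[x1 y1] AB]].
apply: (HX _ _ _ _ (pi_ w) (pj w) (pk w)).
- by move: x1; rewrite !E.
- by move: y1; rewrite !E.
- move: AB; rewrite pevalD !pevalXn => AB; move: A1 AB.
  move: (peval w A) (peval w B) => u v u0 uv.
  by rewrite sqr_ratio // mulf_neq0 // invr_eq0 expf_neq0.
have -> : (f a * w.1 + f b * w.2 + f c) = peval w A by rewrite !E.
have -> : f d * w.1 * w.2 + f e * w.1 + f h * w.2 + f g = peval w B by rewrite !E.
by move: (peval w A) (peval w B) A1 => u v; exact: ratio_root.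
Qed.
End Graph.

(** * Bounds on the rank *)

Section RankBounds.
Variables (R : rcfType) (L : 6.-tuple (dualquat R)) (hL : linkage6R L).

Lemma real_sqrD1_neq0 (x : R) : x ^+ 2 + 1 != 0.
Proof. by rewrite gt_eqF // ltr_wpDl ?sqr_ge0. Qed.

Lemma Ksym_plus_closure (t : 'I_3 -> P1 R) (p : 'I_3 -> R) : Ksym_plus L t ->
  (forall i, t i = Some (p i)) ->
  symmetric_closure L (p (inord 0)) (p (inord 1)) (p (inord 2)).
Proof. by move=> [_ /=]; rewrite /fac_sub /fac_add => e tp; rewrite !tp in e. Qed.

Lemma coord_matrix_monomials_eq0 (x y z : R) : symmetric_closure L x y z ->
  coord_matrix (lambda_matrix L) *m (monomials x y z)^T = 0.
Proof.
move=> e; apply: coord_matrix_mulmx_eq0 => i k; rewrite ord1.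
under eq_bigr => j _ do rewrite mxE.
by apply: lambda_matrix_closure => //; exact: real_sqrD1_neq0.
Qed.

(** The value at infinity of each coordinate is added to the list of values to avoid. *)
Lemma finite_point_avoid (C : set ('I_3 -> P1 R)) : zirreducible C ->
  (forall i, ~ exists a, forall t, C t -> t i = a) ->
  forall s : seq ('I_3 * R), exists2 p : 'I_3 -> R,
    C (fun i => Some (p i)) & forall ia, ia \in s -> p ia.1 != ia.2.
Proof.
move=> irrC ncst s; have [t Ct ht] := zirreducible_avoid
  ([seq (i, None) | i <- enum 'I_3] ++ [seq (ia.1, Some ia.2) | ia <- s]) irrC ncst.
have fin i : t i = Some (odflt 0 (t i)).
  have : t i != None.
    by apply: (ht (i, None)); rewrite mem_cat map_f ?mem_enum.
  by case: (t i).
exists (fun i => odflt 0 (t i)).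
  by have <- : t = (fun i => Some (odflt 0 (t i))) by apply/funext.
move=> ia ias; have : t ia.1 != Some ia.2.
  apply: (ht (ia.1, Some ia.2)).
  by rewrite mem_cat orbC (map_f (fun ia => (ia.1, Some ia.2))).
by rewrite fin; apply: contra_neq => <-.
Qed.

Lemma rank_lambda_matrix_le4 (C : set ('I_3 -> P1 R)) : zirreducible C ->
  (forall i, ~ exists a, forall t, C t -> t i = a) -> C `<=` Ksym_plus L ->
  (\rank (coord_matrix (lambda_matrix L)) <= 4)%N.
Proof.
move=> irrC ncst CK.
have pick := finite_point_avoid irrC ncst; have [p Cp _] := pick [::].
(* [q] differs from [p] in t1 and t2, and [r] from both in t1, as independence of the monomial
   vectors requires. *)
have [q Cq hq] := pick [:: (inord 0, p (inord 0)); (inord 1, p (inord 1))].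
have [r Cr hr] := pick [:: (inord 0, p (inord 0)); (inord 0, q (inord 0))].
have rV : \rank (\matrix_(i < 3, j < 7) (let t := nth p [:: p; q; r] i in
    monomials (t (inord 0)) (t (inord 1)) (t (inord 2)) 0 j)) = 3%N.
  by apply: monomials_rank; rewrite eq_sym ?(hq (_, _)) ?(hr (_, _)) // !inE eqxx ?orbT.
have MV : coord_matrix (lambda_matrix L) *m
   (\matrix_(i < 3, j < 7) (let t := nth p [:: p; q; r] i in
    monomials (t (inord 0)) (t (inord 1)) (t (inord 2)) 0 j))^T = 0.
  apply/matrixP => a i.
  have /CK/Ksym_plus_closure/(_ (fun=> erefl)) :
      C (fun k => Some (nth p [:: p; q; r] i k)).
    by case: i => [[|[|[|]]]] //=.
  move/coord_matrix_monomials_eq0/matrixP/(_ a 0); rewrite !mxE => e.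
  by rewrite -[RHS]e; apply: eq_bigr => j _; congr (_ * _); rewrite !mxE /= mxE.
have := mulmx0_rank_max MV; rewrite mxrank_tr rV.
by rewrite addnC -[7%N]/(3 + 4)%N leq_add2l.
Qed.

(** In rank at most 1 the closure equation follows from one real equation with coefficient row [w],
    whose complex zeros contain a surface. *)
Lemma rank_lambda_matrix_ge2 (x y z : R) : symmetric_closure L x y z ->
  zdim_lt (Ksym (complexify L)) 2 ->
  (1 < \rank (coord_matrix (lambda_matrix L)))%N.
Proof.
move=> clos dim; rewrite ltnNge; apply/negP => /rank_le1P rk; apply: dim.
set M := coord_matrix _ in rk.
(* Index 6 belongs to the monomial 1. If [w] were zero elsewhere, the solution [clos] would force
   [M] = 0; then [u] = 0 and a unit vector at the monomial xy serve instead. *)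
have [u [w [Mw w0]]] : exists (u : 'cV[R]_(\sum_(i < 6) 8)) (w : 'rV[R]_7),
    M = u *m w /\ exists j : 'I_7, (j != inord 6) && (w 0 j != 0).
  case: rk => [M0|[u [w Mw]]].
    exists 0, (delta_mx 0 (inord 0)); split; first by rewrite mul0mx.
    by exists (inord 0); rewrite mxE !eqxx oner_eq0 andbT -val_eqE /= !inordK.
  case: (pselect (exists j, (j != inord 6) && (w 0 j != 0))) => [|nex].
    by exists u, w.
  have w0 j : j != inord 6 -> w 0 j = 0.
    by move=> j6; apply: contra_notP nex => /eqP wj; exists j; rewrite j6.
  have Mv := coord_matrix_monomials_eq0 clos; rewrite -/M Mw -mulmxA in Mv.
  have e : w *m (monomials x y z)^T = (w 0 (inord 6))%:M.
    rewrite [LHS]mx11_scalar; congr (_%:M); rewrite !mxE (bigD1 (inord 6)) //=.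
    by rewrite big1 ?addr0 => [|j /w0 ->]; rewrite ?mul0r // !mxE inordK // mulr1.
  have M0 : M = 0.
    rewrite Mw; have [w6|w6] := eqVneq (w 0 (inord 6)) 0.
      have -> : w = 0; last by rewrite mulmx0.
      by apply/rowP => j; rewrite mxE; have [->|/w0] := eqVneq j (inord 6).
    rewrite e mul_mx_scalar in Mv; move/eqP: Mv; rewrite scalemx_eq0 (negPf w6).
    by move/eqP => ->; rewrite mul0mx.
  exists 0, (delta_mx 0 (inord 0)); split; first by rewrite M0 mul0mx.
  by exists (inord 0); rewrite mxE !eqxx oner_eq0 andbT -val_eqE /= !inordK.
pose f := real_complex R.
(* The factorization through [w] persists over the complex numbers, so the equation of [w] gives the
   closure equation there. *)
have KL (t : 'I_3 -> P1 R[i]) x1 x2 x3 : t (inord 0) = Some x1 ->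
    t (inord 1) = Some x2 -> t (inord 2) = Some x3 ->
    x1 ^+ 2 + 1 != 0 -> x2 ^+ 2 + 1 != 0 -> x3 ^+ 2 + 1 != 0 ->
    \sum_(j < 7) monomials x1 x2 x3 0 j * f (w 0 j) = 0 ->
    Ksym (complexify L) t.
  move=> t1 t2 t3 n1 n2 n3 e.
  have hLC := linkage6R_complexify hL.
  refine (@Ksym_closure _ (complexify L) x1 x2 x3 t hLC t1 t2 t3 n1 n2 n3 _).
  apply/symmetric_closureE; apply/rowP => k; rewrite summxE [RHS]mxE.
  transitivity ((\sum_(j < 7) monomials x1 x2 x3 0 j * f (w 0 j)) *
    f (u (tagnat.Rank ord0 k) 0)); last by rewrite e mul0r.
  rewrite big_distrl; apply: eq_bigr => j _.
  rewrite lambda_matrix_complexify mxE /map_dq [X in _ * X]mxE /= -mulrA; congr (_ * _).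
  rewrite -coord_matrix_Rank -/M Mw mxE big_ord1 mulrC.
  exact: rmorphM.
have [j /andP[j6 wj]] := w0.
have ne (m n : nat) : (m < 3)%N -> (n < 3)%N -> (m != n)%N ->
  (inord m : 'I_3) != inord n by move=> ? ? ?; rewrite -val_eqE /= !inordK.
have S x1 x2 x3 : \sum_(j < 7) monomials x1 x2 x3 0 j * f (w 0 j) =
    x1 * x2 * f (w 0 (inord 0)) + x1 * x3 * f (w 0 (inord 1)) +
    x2 * x3 * f (w 0 (inord 2)) + x3 * f (w 0 (inord 3)) +
    x2 * f (w 0 (inord 4)) + x1 * f (w 0 (inord 5)) + f (w 0 (inord 6)).
  rewrite !big_ord_recr big_ord0 /= add0r !mxE /= mul1r.
  by do 6?[congr (_ + _)]; do ?congr (_ * _); congr (f (w 0 _));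
    apply: val_inj; rewrite /= inordK.
(* Every monomial except 1 contains a variable. The three groups are the coefficients of z, y and x,
   and the equation is solved for a variable whose group is nonzero. *)
have : [|| [|| w 0 (inord 1) != 0, w 0 (inord 2) != 0 | w 0 (inord 3) != 0],
  [|| w 0 (inord 0) != 0, w 0 (inord 2) != 0 | w 0 (inord 4) != 0] |
  [|| w 0 (inord 0) != 0, w 0 (inord 1) != 0 | w 0 (inord 5) != 0]].
  move: j6 wj; rewrite -(inord_val j); case: j => [[|[|[|[|[|[|[|]]]]]]]] //= _ j6 wj;
    rewrite ?wj ?orbT //.
  by rewrite eqxx in j6.
case/or3P => nz.
- apply: (@zdim_ge2_graph _ _ f _ (inord 0) (inord 1) (inord 2) _ _ _
    (w 0 (inord 0)) (w 0 (inord 5)) (w 0 (inord 4)) (w 0 (inord 6)) _ _ _ nz);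
    rewrite ?ne //.
  move=> t x1 x2 x3 t1 t2 t3 n1 n2 n3 e; apply: (KL t x1 x2 x3) => //.
  by rewrite S -[RHS]e; ring.
- apply: (@zdim_ge2_graph _ _ f _ (inord 0) (inord 2) (inord 1) _ _ _
    (w 0 (inord 1)) (w 0 (inord 5)) (w 0 (inord 3)) (w 0 (inord 6)) _ _ _ nz);
    rewrite ?ne //.
  move=> t x1 x3 x2 t1 t3 t2 n1 n3 n2 e; apply: (KL t x1 x2 x3) => //.
  by rewrite S -[RHS]e; ring.
apply: (@zdim_ge2_graph _ _ f _ (inord 1) (inord 2) (inord 0) _ _ _
    (w 0 (inord 2)) (w 0 (inord 4)) (w 0 (inord 3)) (w 0 (inord 6)) _ _ _ nz);
    rewrite ?ne //.
move=> t x2 x3 x1 t2 t3 t1 n2 n3 n1 e; apply: (KL t x1 x2 x3) => //.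
by rewrite S -[RHS]e; ring.
Qed.
End RankBounds.

Theorem theorem1 (R : realType) (L : 6.-tuple (dualquat R))
    (hL : linkage6R L)
    (hdim : zdim_lt (Ksym (complexify L)) 2)
    (hcomp : exists C : set ('I_3 -> P1 R),
       nondegenerate_component L C /\ C `<=` Ksym_plus L) :
  \rank (coord_matrix (lambda_matrix L)) \in [:: 2; 3; 4]%N.
Proof.
have [C [[[_ irrC _] _ ncst] CK]] := hcomp.
have le4 := rank_lambda_matrix_le4 hL irrC ncst CK.
(* A finite point of [C] supplies the real solution needed for the lower bound. *)
have [p Cp _] := finite_point_avoid irrC ncst [::].
have ge2 := rank_lambda_matrix_ge2 hL (Ksym_plus_closure (CK _ Cp) (fun=> erefl)) hdim.
by move: le4 ge2; case: (\rank _) => [|[|[|[|[|]]]]].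
Qed.
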